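(* Let $d\ge 2$ be an integer and let $$y(d)=\frac{((2d-2)!)^d}{N(d)\binom{2d-2}{d}\binom{2d-2}{d-1}\left( 2((d-1)!)^d-(d-1)^2\left( d-1+\frac1d\right)((d-2)!)^d\right)}.$$ Then for every positive integer $t$ with $t>y(d)\cdot d\log\left((2d-2)!\right)$, we have $\chi_c^\star(K_{d,t})\ge 2d-1$.
   Context: $K_{d,t}$ is the complete bipartite graph with parts of sizes $d$ and $t$. $N(d)$ denotes the number of Latin squares of order $d$ (i.e. $d\times d$ arrays with entries from $\{1,\dots,d\}$ in which every row and every column has distinct entries), and $\log$ is the natural logarithm. For a graph $G$ and a positive integer $k$, a $k$-fold correspondence-cover of $G$ is a graph $H$ whose vertex set is partitioned into sets $L(v)=\{1_v,\dots,k_v\}$, $v\in V(G)$, such that each $L(v)$ is independent in $H$, there are no edges of $H$ between $L(u)$ and $L(v)$ when $uv\notin E(G)$, and for every edge $uv\in E(G)$ the edges of $H$ between $L(u)$ and $L(v)$ form a matching. A correspondence-colouring of $H$ is an independent set of $H$ containing exactly one vertex of each $L(v)$. A correspondence-packing of $H$ is a collection of $k$ pairwise disjoint correspondence-colourings of $H$. The correspondence packing number $\chi_c^\star(G)$ is the least $k$ such that every $k$-fold correspondence-cover of $G$ admits a correspondence-packing. *)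

(* Defs.v *)
(* MathComp / MathComp-Analysis *)
From mathcomp Require Import all_boot all_order all_fingroup all_algebra.
From mathcomp Require Import boolp reals.

Set Implicit Arguments.
Unset Strict Implicit.
Unset Printing Implicit Defensive.

Import Order.TTheory GRing.Theory Num.Theory.

Record sgraph := SGraph {
  svertex :> finType;
  sedge : rel svertex;
  sedge_sym : symmetric sedge;
  sedge_irr : irreflexive sedge
}.

Definition Kbip_edge (d t : nat) (x y : 'I_d + 'I_t) : bool :=
  match x, y with
  | inl _, inr _ | inr _, inl _ => true
  | _, _ => false
  end.

Lemma Kbip_sym (d t : nat) : symmetric (@Kbip_edge d t).
Proof. by case=> i [j|j]. Qed.

Lemma Kbip_irr (d t : nat) : irreflexive (@Kbip_edge d t).
Proof. by case. Qed.

Definition Kbip (d t : nat) : sgraph :=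
  SGraph (@Kbip_sym d t) (@Kbip_irr d t).

(* The pair (v, i) is the vertex i_v of the cover, so that
   L(v) = [set x | x.1 == v].  In [corr_matching] the edge uv is quantified in
   both orientations, so together with [corr_sym] it forbids two cover edges
   between L(u) and L(v) from sharing an endpoint on either side. *)
Record corr_cover (G : sgraph) (k : nat) := CorrCover {
  corr_edge :> rel (G * 'I_k);
  corr_sym : symmetric corr_edge;
  corr_irr : irreflexive corr_edge;
  corr_indep : forall (v : G) (i j : 'I_k), ~~ corr_edge (v, i) (v, j);
  corr_nonadj : forall (u v : G) (i j : 'I_k),
    u != v -> ~~ sedge u v -> ~~ corr_edge (u, i) (v, j);
  corr_matching : forall (u v : G) (i j j' : 'I_k), sedge u v ->
    corr_edge (u, i) (v, j) -> corr_edge (u, i) (v, j') -> j = j'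
}.

Definition corr_colouring (G : sgraph) (k : nat) (H : corr_cover G k)
    (I : {set G * 'I_k}) : Prop :=
  {in I &, forall x y, ~~ H x y} /\
  forall v : G, #|I :&: [set x | x.1 == v]| = 1.

Definition corr_packing (G : sgraph) (k : nat) (H : corr_cover G k)
    (C : 'I_k -> {set G * 'I_k}) : Prop :=
  (forall c : 'I_k, corr_colouring H (C c)) /\
  (forall c c' : 'I_k, c != c' -> [disjoint C c & C c']).

Definition corr_packable (G : sgraph) (k : nat) : Prop :=
  forall H : corr_cover G k, exists C, corr_packing H C.

Lemma avoiding_perm (k m : nat) (bad : rel 'I_k) :
  (m.*2 < k)%N ->
  (forall i, #|[set x | bad i x]| <= m)%N ->
  (forall x, #|[set i | bad i x]| <= m)%N ->
  exists p : {perm 'I_k}, forall i, ~~ bad i (p i).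
Proof.
move=> mk rowb colb.
pose B (p : {perm 'I_k}) := [set i | bad i (p i)].
case: (@arg_minnP _ (1%g : {perm 'I_k}) xpredT (fun p => #|B p|)) => // p _ pmin.
exists p => i; apply/negP => bi.
pose X := [set j | bad i (p j)] :|: [set j | bad j (p i)].
have cX : (#|X| < k)%N.
  apply: leq_ltn_trans mk; apply: leq_trans (leq_card_setU _ _) _.
  rewrite -addnn leq_add //.
  have -> : [set j | bad i (p j)] = p @^-1: [set x | bad i x].
    by apply/setP => j; rewrite !inE.
  by rewrite card_preimset //; exact: perm_inj.
have [j jX] : exists j, j \notin X.
  apply/existsP; rewrite -negb_forall; apply/negP => /forallP allX.
  have XT : X = [set: 'I_k] by apply/setP => j; rewrite allX in_setT.
  by move: cX; rewrite XT cardsT card_ord ltnn.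
move: jX; rewrite !inE negb_or => /andP[nij nji].
have := pmin (tperm i j * p)%g isT; rewrite leqNgt => /negP; apply.
apply: proper_card; apply/properP; split; last first.
  by exists i; rewrite !inE ?bi // permM tpermL.
apply/subsetP => l; rewrite !inE permM.
case: tpermP => [->|->|//]; by [rewrite (negbTE nij) | rewrite (negbTE nji)].
Qed.

Lemma corr_partial (G : sgraph) (k : nat) (H : corr_cover G k) (s : seq G) :
  (#|G|.*2 < k)%N ->
  exists phi : G -> {perm 'I_k}, forall u v, u \in s -> v \in s ->
    forall c, ~~ H (u, phi u c) (v, phi v c).
Proof.
move=> kG; elim: s => [|w s [phi IH]]; first by exists (fun=> 1%g).
have [ws|ws] := boolP (w \in s).
  by exists phi => u v; rewrite !inE => /predU1P[->|us] /predU1P[->|vs]; exact: IH.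
have Hadj u v i j : H (u, i) (v, j) -> sedge u v.
  move=> Huv; have [uv|uv] := eqVneq u v.
    by have := corr_indep H v i j; rewrite -{1}uv Huv.
  by apply/negPn/negP => /(corr_nonadj H i j uv); rewrite Huv.
have card_cup (A : G -> {set 'I_k}) :
    (forall u, #|A u| <= 1)%N -> (#|\bigcup_u A u| <= #|G|)%N.
  move=> A1; have -> : #|G| = (\sum_(u : G) 1)%N by rewrite sum1_card.
  elim/big_rec2: _ => [|u n X _ IHX]; first by rewrite cards0.
  by rewrite (leq_trans (leq_card_setU _ _)) // leq_add.
pose A c u := [set x | H (u, phi u c) (w, x)].
pose A' x u := [set c | H (u, phi u c) (w, x)].
pose bad c x := [exists u, H (u, phi u c) (w, x)].
have [||p pP] := @avoiding_perm k #|G| bad kG.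
- move=> c; rewrite (_ : [set _ | _] = \bigcup_u A c u).
    apply: card_cup => u; apply/card_le1_eqP => x y; rewrite !inE => h1 h2.
    exact: (corr_matching (Hadj _ _ _ _ h1) h2 h1).
  apply/setP => x; rewrite inE; apply/existsP/bigcupP => -[u].
    by exists u; rewrite ?inE.
  by rewrite inE; exists u.
- move=> x; rewrite (_ : [set _ | _] = \bigcup_u A' x u).
    apply: card_cup => u; apply/card_le1_eqP => c c'.
    rewrite !inE !(corr_sym H _ (w, x)) => h1 h2.
    exact: (perm_inj (corr_matching (Hadj _ _ _ _ h1) h2 h1)).
  apply/setP => c; rewrite inE; apply/existsP/bigcupP => -[u].
    by exists u; rewrite ?inE.
  by rewrite inE; exists u.
exists (fun u => if u == w then p else phi u) => u v.
have pPu u' c : ~~ H (u', phi u' c) (w, p c).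
  by have := pP c; rewrite negb_exists => /forallP.
rewrite !inE; case: eqVneq => [->|uw] /=; case: eqVneq => [->|vw] //= us vs c.
- exact: corr_indep.
- by rewrite corr_sym.
- exact: IH.
Qed.

Lemma corr_packable_exists (G : sgraph) :
  exists k, (0 < k)%N && `[< corr_packable G k >].
Proof.
exists (#|G|.*2.+1); apply/andP; split=> //; apply/asboolP => H.
have [phi phiP] := corr_partial H (enum G) (ltnSn _).
exists (fun c => [set x | x.2 == phi x.1 c]); split=> [c|c c' cc'].
  split=> [[u i] [v j]|v].
    by rewrite !inE /= => /eqP-> /eqP->; apply: phiP; rewrite mem_enum.
  apply/eqP/cards1P; exists (v, phi v c); apply/setP => -[u i].
  rewrite !inE /= xpair_eqE andbC.
  by case: eqVneq => [->|].
rewrite -setI_eq0; apply/eqP/setP => -[u i]; rewrite !inE /=.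
apply/negP => /andP[/eqP -> /eqP/perm_inj ccE].
by rewrite ccE eqxx in cc'.
Qed.

(* The least k >= 1 such that every k-fold cover of G has a packing; the lemma
   above shows that such a k exists, so no default value is involved. *)
Definition corr_packing_number (G : sgraph) : nat :=
  ex_minn (corr_packable_exists G).

Definition is_latin (d : nat) (A : 'M['I_d]_d) : bool :=
  [forall i, injectiveb (fun j => A i j)] &&
  [forall j, injectiveb (fun i => A i j)].

Definition num_latin (d : nat) : nat := #|[set A : 'M['I_d]_d | is_latin A]|.

Local Open Scope ring_scope.

Definition ybound (R : realType) (d : nat) : R :=
  ((2 * d - 2)`!)%:R ^+ d /
  ((num_latin d)%:R * 'C(2 * d - 2, d)%:R * 'C(2 * d - 2, d - 1)%:R *
   (2%:R * ((d - 1)`!)%:R ^+ d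
    - (d%:R - 1) ^+ 2 * (d%:R - 1 + d%:R^-1) * ((d - 2)`!)%:R ^+ d)).

(* Main.v *)
(* Put k = 2d - 2.  Give every vertex b of the side of size t a random d-tuple of
   permutations of the k indices, which are its matchings to the d vertices of
   the other side.  A packing of those d vertices is a tuple phi of permutations,
   and it extends to b iff some permutation disagrees everywhere with all d
   products phi_a * s_b,a; call such a tuple of products avoidable.  There are
   (k!)^d choices of phi, so a union bound gives a cover without packing as soon
   as (k!)^d (1 - P)^t < 1, where P is the probability that a tuple is not
   avoidable.

   A tuple p covers S x T if every c in S and x in T satisfy p_a c = x for some a.
   If #|S| + #|T| > k, this makes p unavoidable.  Blocks of shape (d-1, d) or
   (d, d-1) are Latin rectangles, each of which completes uniquely to a Latin
   square, so each given block is covered by N(d) ((d-1)!)^d tuples.  Covered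
   blocks can only coexist in two ways: they are the 2d sub-blocks of one covered
   d x d block, or they are two sub-blocks of a d x d block covered up to one
   cell.  Subtracting the overcount gives the denominator of [ybound]. *)
Require Import Defs.
From mathcomp Require Import all_boot all_order all_fingroup all_algebra.
From mathcomp Require Import boolp reals sequences exp.
From mathcomp Require Import zify ring lra.
Import Order.TTheory GRing.Theory Num.Theory.

Set Implicit Arguments.
Unset Strict Implicit.
Unset Printing Implicit Defensive.

(** * Covered blocks in a relation of degree at most [d] *)

Definition covers (V : finType) (r : rel V) (S T : {set V}) : bool :=
  [forall c in S, [forall x in T, r c x]].

Definition nblocks (V : finType) (r : rel V) (m n : nat) : nat :=
  #|[set B : {set V} * {set V} |
      [&& #|B.1| == m, #|B.2| == n & covers r B.1 B.2]]|.

(** For [c] in [U] and [x] in [T], the three conditions together say that [(c, x)] is the only cell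
    of the block where [r] fails. *)
Definition near_block (V : finType) (r : rel V) (U T : {set V}) (c x : V) : bool :=
  [&& covers r (U :\ c) T, covers r U (T :\ x) & ~~ covers r U T].

Definition nnear (V : finType) (r : rel V) (d : nat) : nat :=
  #|[set B : ({set V} * {set V}) * (V * V) |
      [&& #|B.1.1| == d, #|B.1.2| == d, B.2.1 \in B.1.1, B.2.2 \in B.1.2
        & near_block r B.1.1 B.1.2 B.2.1 B.2.2]]|.

Definition transpose (V : Type) (r : rel V) : rel V := fun x y => r y x.

Lemma coversP (V : finType) (r : rel V) (S T : {set V}) :
  reflect (forall c x, c \in S -> x \in T -> r c x) (covers r S T).
Proof.
apply: (iffP forall_inP) => [h c x cS xT|h c cS].
  by have /forall_inP := h c cS; apply.
by apply/forall_inP => x; apply: h.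
Qed.

Lemma covers_transpose (V : finType) (r : rel V) (S T : {set V}) :
  covers (transpose r) S T = covers r T S.
Proof. by apply/coversP/coversP => h c x cS xT; apply: h. Qed.

Lemma nblocks_transpose (V : finType) (r : rel V) (m n : nat) :
  nblocks (transpose r) m n = nblocks r n m.
Proof.
have swapI : injective (fun B : {set V} * {set V} => (B.2, B.1)).
  by move=> [a b] [a' b'] [-> ->].
rewrite /nblocks -(card_preimset _ swapI).
apply: eq_card => -[S T]; rewrite !inE /= covers_transpose.
by rewrite andbCA.
Qed.

(** By the degree bound, a covered block with [d] columns has as its column set the full row of each
    of its elements. All covered blocks therefore share one column set [T0], and only the choice of
    the [d.-1] rows remains. *)
Lemma nblocks_le (V : finType) (r : rel V) (d : nat) :
  2 <= d -> #|V| = 2 * d - 2 ->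
  (forall c, #|[set x | r c x]| <= d) -> (forall x, #|[set c | r c x]| <= d) ->
  nblocks r d.-1 d <= 1 \/
  nblocks r d.-1 d <= d /\ 0 < nblocks r d d.
Proof.
have maxc (B : {set V}) : #|B| <= #|V| := max_card _.
move=> d2 cV degr degc; rewrite /nblocks; set A := [set _ | _].
have [->|[[S0 T0]]] := set_0Vmem A; first by left; rewrite cards0.
rewrite inE /= => /and3P[/eqP cS0 /eqP cT0 /coversP cov0].
(* [W] collects all possible rows over [T0]. It has at most [d] elements; if exactly [d], then
   [(W, T0)] is itself a covered block. *)
pose W := [set c | T0 \subset [set x | r c x]].
have [x0 x0T] : exists x, x \in T0 by apply/card_gt0P; rewrite cT0; lia.
have cW : #|W| <= d.
  apply: leq_trans (degc x0); apply: subset_leq_card; apply/subsetP => c.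
  by rewrite !inE => /subsetP/(_ x0 x0T); rewrite inE.
have rowE (S T : {set V}) c : #|T| = d -> covers r S T -> c \in S -> T = [set x | r c x].
  move=> cT /coversP cov cS; apply/eqP; rewrite eqEcard cT degr andbT.
  by apply/subsetP => x xT; rewrite inE cov.
have AW : A \subset setX [set S : {set V} | S \subset W & #|S| == d.-1] [set T0].
  apply/subsetP => -[S T]; rewrite !inE /= => /and3P[/eqP cS /eqP cT covST].
  have TE : T = T0.
    have [dis|[c]] := set_0Vmem (S :&: S0); last first.
      rewrite inE => /andP[cSS cS0'].
      by rewrite (rowE _ _ _ cT covST cSS) (rowE S0 T0 c) //; apply/coversP.
    (* Disjoint row sets fill [V], so a common column is hit by all [2 * d - 2] elements. This
       forces [d = 2], where [T] and [T0] are both all of [V]. *)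
    have cU : #|S :|: S0| = #|V| by rewrite cardsU dis cards0; lia.
    have [x] : exists x, x \in T :&: T0.
      apply/card_gt0P; have := cardsUI T T0.
      have := maxc (T :|: T0); lia.
    rewrite inE => /andP[xT xT0].
    have : #|S :|: S0| <= d.
      apply: leq_trans (degc x); apply: subset_leq_card; apply/subsetP => c.
      rewrite !inE => /orP[cS1|cS1]; first by move/coversP: covST; apply.
      exact: cov0.
    rewrite cU cV => d2'.
    have TT (B : {set V}) : #|B| = d -> B = setT.
      by move=> cB; apply/eqP; rewrite eqEcard subsetT cardsT cV cB; lia.
    by rewrite (TT T cT) (TT T0 cT0).
  rewrite cS TE !eqxx !andbT; apply/subsetP => c cSS; rewrite inE.
  by rewrite -TE -(rowE _ _ _ cT covST cSS).
have := subset_leq_card AW; rewrite cardsX cards1 muln1 cards_draws => cA.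
case: (ltnP #|W| d) => Wd.
  left; apply: leq_trans cA _.
  have [->|ne] := eqVneq #|W| d.-1; first by rewrite binn.
  by rewrite bin_small //; lia.
have WE : #|W| = d by apply/eqP; rewrite eqn_leq cW.
right; split.
  by apply: leq_trans cA _; rewrite WE -subn1 bin_sub ?bin1; lia.
apply/card_gt0P; exists (W, T0); rewrite inE /= WE cT0 !eqxx /=.
apply/coversP => c x; rewrite inE => /subsetP sub xT.
by have := sub x xT; rewrite inE.
Qed.

(** Blocks of the two shapes meet in a cell [(c, x)]. There [T] is the full row of [c] and [U] the
    full column of [x], so [S] is [U] minus one element and [T'] is [T] minus one. Hence at most one
    cell of [U] times [T] is uncovered. *)
Lemma block_overlap (V : finType) (r : rel V) (d : nat) :
  2 <= d -> #|V| = 2 * d - 2 ->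
  (forall c, #|[set x | r c x]| <= d) -> (forall x, #|[set c | r c x]| <= d) ->
  0 < nblocks r d.-1 d -> 0 < nblocks r d d.-1 ->
  0 < nblocks r d d + nnear r d.
Proof.
have maxc (B : {set V}) : #|B| <= #|V| := max_card _.
move=> d2 cV degr degc /card_gt0P[[S T]] + /card_gt0P[[U T']].
rewrite !inE /= => /and3P[/eqP cS /eqP cT /coversP covST].
move=> /and3P[/eqP cU /eqP cT' /coversP covUT'].
have meet (A B : {set V}) : #|A| = d.-1 -> #|B| = d -> exists c, c \in A :&: B.
  move=> cA cB; apply/card_gt0P.
  have := cardsUI A B; have := maxc (A :|: B); lia.
have [c] := meet _ _ cS cU; rewrite inE => /andP[cS1 cU1].
have [x] := meet _ _ cT' cT; rewrite inE => /andP[xT' xT].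
have TE : T = [set x | r c x].
  apply/eqP; rewrite eqEcard cT degr andbT.
  by apply/subsetP => y yT; rewrite inE covST.
have UE : U = [set c | r c x].
  apply/eqP; rewrite eqEcard cU degc andbT.
  by apply/subsetP => y yT; rewrite inE covUT'.
have SU : S \subset U by rewrite UE; apply/subsetP => y yS; rewrite inE covST.
have T'T : T' \subset T by rewrite TE; apply/subsetP => y yS; rewrite inE covUT'.
have one (A B : {set V}) : A \subset B -> #|A| = d.-1 -> #|B| = d ->
    exists2 z, z \in B & A = B :\ z.
  move=> AB cA cB; have : #|B :\: A| == 1.
    by rewrite cardsD (setIidPr AB); lia.
  case/cards1P=> z zE; exists z.
    by have : z \in B :\: A by [rewrite zE set11]; rewrite inE => /andP[].
  by rewrite -zE setDDr setDv set0U (setIidPr AB).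
have [c0 c0U SE] := one _ _ SU cS cU.
have [x0 x0T T'E] := one _ _ T'T cT' cT.
rewrite addn_gt0; case cov: (covers r U T).
  apply/orP; left; apply/card_gt0P; exists (U, T).
  by rewrite inE /= cU cT cov !eqxx.
apply/orP; right; apply/card_gt0P; exists ((U, T), (c0, x0)).
rewrite inE /= cU cT !eqxx c0U x0T /near_block cov -SE -T'E /= andbT.
by apply/andP; split; apply/coversP.
Qed.

(** If a [d] by [d] block is covered, the left side is at most [2 * d], that is, [1] plus one
    correction of [2 * d - 1]. Otherwise each shape occurs at most once, and if both occur a near
    block pays for the second. *)
Lemma nblocks_bound (V : finType) (r : rel V) (d : nat) :
  2 <= d -> #|V| = 2 * d - 2 ->
  (forall c, #|[set x | r c x]| <= d) -> (forall x, #|[set c | r c x]| <= d) ->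
  nblocks r d.-1 d + nblocks r d d.-1 <=
  (0 < nblocks r d.-1 d + nblocks r d d.-1) +
  ((2 * d - 1) * nblocks r d d + nnear r d).
Proof.
move=> d2 cV degr degc.
have h1 := nblocks_le d2 cV degr degc.
have h2 := nblocks_le (r := transpose r) d2 cV degc degr.
rewrite !(nblocks_transpose r) in h2.
have h3 := block_overlap d2 cV degr degc.
move: (nblocks r d.-1 d) (nblocks r d d.-1) (nblocks r d d) (nnear r d) h1 h2 h3.
move=> a b f h h1 h2 h3.
have [f0|fp] := posnP f.
  by move: h1 h2 h3; rewrite f0 muln0; lia.
have : (2 * d - 1) <= (2 * d - 1) * f by rewrite leq_pmulr.
by have [ab|ab] := posnP (a + b); lia.
Qed.

(** * Permutations: unavoidable blocks and extensions of partial maps *)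

Lemma no_avoiding_perm (V : finType) (r : rel V) (q : {perm V}) (S T : {set V}) :
  #|V| < #|S| + #|T| -> covers r S T -> exists c, r c (q c).
Proof.
have maxc (B : {set V}) : #|B| <= #|V| := max_card _.
move=> lt /coversP cov.
(* Pigeonhole: the image of [S] under [q] and [T] are too large to be disjoint. *)
have [x] : exists x, x \in (q @: S) :&: T.
  apply/card_gt0P; have := cardsUI (q @: S) T.
  rewrite card_imset; last exact: perm_inj.
  have := maxc ((q @: S) :|: T); lia.
rewrite inE => /andP[/imsetP[c cS ->] xT]; exists c; exact: cov.
Qed.

Lemma perm_extension (V I : finType) (e f : I -> V) (s : seq I) :
  injective e -> injective f ->
  exists q : {perm V}, forall j, j \in s -> q (e j) = f j.
Proof.
move=> einj finj; elim: s => [|i s [q qE]]; first by exists 1%g.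
have [js|njs] := boolP (i \in s).
  by exists q => j; rewrite inE => /predU1P[->|]; apply: qE.
(* The transposition corrects the value at [e i]; by injectivity of [e] and [f] it fixes every value
   [f j] prescribed earlier. *)
exists (q * tperm (q (e i)) (f i))%g => j; rewrite permM inE.
have [->|ji] := eqVneq j i; first by rewrite tpermL.
move=> /= js; rewrite (qE j js) tpermD //; last by rewrite (inj_eq finj) eq_sym.
by rewrite -(qE j js) (inj_eq perm_inj) (inj_eq einj) eq_sym.
Qed.

(** The extensions form a coset: dividing by one extension [q0] leaves exactly the permutations that
    fix [e @: J] pointwise. *)
Lemma card_perm_extensions (V I : finType) (e f : I -> V) (J : {set I}) :
  injective e -> injective f ->
  #|[set q : {perm V} | [forall j in J, q (e j) == f j]]| = (#|V| - #|J|)`!.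
Proof.
move=> einj finj; have [q0 q0E] := perm_extension (enum J) einj finj.
have -> : #|V| - #|J| = #|~: (e @: J)| by rewrite [RHS]cardsCs setCK card_imset.
rewrite -card_perm -[RHS]cardsE -[RHS](card_preimset _ (mulIg q0^-1%g)).
apply: eq_card => q; rewrite !inE.
apply/forall_inP/subsetP => [h z|h j jJ].
  rewrite !inE /= permM; apply: contra => /imsetP[j jJ ->].
  by rewrite (eqP (h j jJ)) -(q0E j) ?mem_enum // permK.
apply/eqP; rewrite -(q0E j) ?mem_enum //.
apply/eqP; apply/negPn/negP => ne.
have : e j \in ~: (e @: J).
  apply: h; rewrite !inE /= permM; apply: contra ne => /eqP E.
  by rewrite -{2}E permKV.
by rewrite inE imset_f.
Qed.

(** * The relation defined by a tuple of permutations *)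

Definition hits (d : nat) (V : finType) (p : {ffun 'I_d -> {perm V}}) : rel V :=
  fun c x => [exists a, p a c == x].

Lemma hits_degr (d : nat) (V : finType) (p : {ffun 'I_d -> {perm V}}) c :
  #|[set x | hits p c x]| <= d.
Proof.
rewrite (_ : [set x | _] = [set p a c | a in 'I_d]).
  by rewrite (leq_trans (leq_imset_card _ _)) // card_ord.
apply/setP => x; rewrite inE; apply/existsP/imsetP => [[a /eqP <-]|[a _ ->]].
  by exists a.
by exists a.
Qed.

(** Inverting every permutation transposes [hits], which carries results from one block shape to the
    other. *)
Definition inv_tuple (d : nat) (V : finType) (p : {ffun 'I_d -> {perm V}}) :
  {ffun 'I_d -> {perm V}} := [ffun a => (p a)^-1%g].

Lemma inv_tuple_inj (d : nat) (V : finType) : injective (@inv_tuple d V).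
Proof.
by move=> p q /ffunP E; apply/ffunP => a; have := E a; rewrite !ffunE => /invg_inj.
Qed.

Lemma hits_inv (d : nat) (V : finType) (p : {ffun 'I_d -> {perm V}}) :
  hits (inv_tuple p) =2 transpose (hits p).
Proof.
move=> x c; rewrite /hits /transpose; apply: eq_existsb => a.
by rewrite ffunE; apply/eqP/eqP => [<-|<-]; rewrite ?permKV ?permK.
Qed.

Lemma hits_degc (d : nat) (V : finType) (p : {ffun 'I_d -> {perm V}}) x :
  #|[set c | hits p c x]| <= d.
Proof.
apply: leq_trans (hits_degr (inv_tuple p) x); apply: eq_leq.
by apply: eq_card => c; rewrite !inE hits_inv.
Qed.

Lemma exists_enumeration (V : finType) (U : {set V}) (d : nat) :
  #|U| = d -> exists e : 'I_d -> V, injective e /\ e @: setT = U.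
Proof.
move=> cU; exists (fun j => enum_val (cast_ord (esym cU) j)); split.
  by move=> i j /enum_val_inj/cast_ord_inj.
apply/setP => z; apply/imsetP/idP => [[j _ ->]|zU]; first exact: enum_valP.
by exists (cast_ord cU (enum_rank_in zU z)); rewrite // cast_ordK enum_rankK_in.
Qed.

(** * Latin squares read off from covered blocks *)

Lemma latinP (d : nat) (L : 'M['I_d]_d) :
  reflect ((forall i, injective (L i)) /\ (forall j, injective (L ^~ j)))
    (is_latin L).
Proof.
apply: (iffP andP) => -[h1 h2]; split.
- by move=> i; apply/injectiveP; apply: (forallP h1).
- by move=> j; apply/injectiveP; apply: (forallP h2).
- by apply/forallP => i; apply/injectiveP; apply: h1.
- by apply/forallP => j; apply/injectiveP; apply: h2.
Qed.

Lemma ord_inj_surj (d : nat) (f : 'I_d -> 'I_d) (y : 'I_d) :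
  injective f -> exists a, f a = y.
Proof. by move=> finj; exists (invF finj y); rewrite f_invF. Qed.

(* Each row of the rectangle misses one symbol, and no two rows miss the same
   one: the missing symbols form column [j0]. *)
Lemma covers_latin (d : nat) (V : finType) (p : {ffun 'I_d -> {perm V}})
    (e f : 'I_d -> V) (j0 : 'I_d) :
  injective e -> injective f ->
  (forall j y, j != j0 -> hits p (e j) (f y)) ->
  exists L : 'M['I_d]_d, is_latin L /\
    forall a j, j != j0 -> p a (e j) = f (L a j).
Proof.
move=> einj finj cov.
(* The [d] values [p a (e j)] must include all [d] values of [f], so by cardinality they are
   distinct and are nothing else. *)
have colP j : j != j0 ->
    exists g : 'I_d -> 'I_d, injective g /\ forall a, p a (e j) = f (g a).
  move=> jj0; have sub : f @: setT \subset [set p a (e j) | a in 'I_d].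
    apply/subsetP => _ /imsetP[y _ ->]; have /existsP[a /eqP <-] := cov j y jj0.
    exact: imset_f.
  have imE : f @: setT = [set p a (e j) | a in 'I_d].
    apply/eqP; rewrite eqEcard sub card_imset // cardsT.
    exact: leq_imset_card.
  have pinj : injective (fun a => p a (e j)).
    apply: in2T; apply/imset_injP.
    by rewrite -imE card_imset // cardsT.
  have ex a : exists y, p a (e j) == f y.
    have : p a (e j) \in f @: setT by rewrite imE imset_f.
    by case/imsetP => y _ ->; exists y.
  exists (fun a => xchoose (ex a)); split=> [a a' E|a]; last first.
    exact/eqP/(xchooseP (ex a)).
  by apply: pinj; rewrite (eqP (xchooseP (ex a))) E -(eqP (xchooseP (ex a'))).
pose S := [set j : 'I_d | j != j0].
have cS : #|S| = d.-1.
  have -> : S = ~: [set j0] by apply/setP => j; rewrite !inE.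
  by rewrite cardsC1 card_ord.
have missing a : exists y, f y \notin [set p a (e j) | j in S].
  apply/existsP; rewrite -negb_forall; apply/negP => /forallP all.
  have : f @: setT \subset [set p a (e j) | j in S].
    by apply/subsetP => _ /imsetP[y _ ->]; exact: all.
  move=> /subset_leq_card; rewrite card_imset // cardsT card_ord => le.
  have := leq_trans le (leq_imset_card _ _); rewrite cS.
  by have := ltn_ord j0; lia.
pose m a := xchoose (missing a).
have mP a j : j != j0 -> p a (e j) <> f (m a).
  move=> jj0 E; have := xchooseP (missing a); rewrite -/(m a) -E.
  by rewrite imset_f // inE.
have m_inj : injective m.
  move=> a a' E; apply/eqP; apply/negPn/negP => aa'.
  pose R := [set b | f (m a) \in [set p b (e j) | j in S]].
  have cR : #|R| <= d.-2.
    have -> : d.-2 = #|~: [set a; a']|.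
      by rewrite cardsCs setCK cards2 aa' card_ord; lia.
    apply: subset_leq_card; apply/subsetP => b; rewrite !inE negb_or.
    move=> /imsetP[j]; rewrite inE => jj0 Eb; apply/andP; split; apply/eqP => ba.
      by apply: (@mP a j jj0); rewrite Eb ba.
    by apply: (@mP a' j jj0); rewrite -E Eb ba.
  (* Each of the [d.-1] columns in [S] contains the symbol [f (m a)], and one row contributes at
     most one column, so [R] needs [d.-1] rows. Missing both [a] and [a'], it has at most [d.-2]. *)
  have sub : e @: S \subset [set (p b)^-1%g (f (m a)) | b in R].
    apply/subsetP => _ /imsetP[j + ->]; rewrite inE => jj0.
    have /existsP[b /eqP Eb] := cov j (m a) jj0.
    apply/imsetP; exists b; last by rewrite -Eb permK.
    by rewrite inE; apply/imsetP; exists j; rewrite ?inE.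
  have := leq_trans (subset_leq_card sub) (leq_imset_card _ _).
  rewrite card_imset // cS.
  have := max_card [set a; a']; rewrite cards2 aa' card_ord; lia.
have colx j : exists g : 'I_d -> 'I_d, injective g /\
    (if j == j0 then forall a, g a = m a else forall a, p a (e j) = f (g a)).
  case: eqVneq => [_|/colP[g gP]]; first by exists m.
  by exists g.
have [g gP] := choice colx.
exists (\matrix_(a, j) g j a)%R; split; last first.
  by move=> a j jj0; have [_] := gP j; rewrite (negbTE jj0) mxE; apply.
apply/latinP; split=> [a j j'|j a a'].
  rewrite !mxE; have [_] := gP j; have [_] := gP j'.
  case: (eqVneq j j0) => [->|jj0]; case: (eqVneq j' j0) => [->|jj0'] // h' h E.
  - by case: (@mP a j' jj0'); rewrite h' -E h.
  - by case: (@mP a j jj0); rewrite h E h'.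
  - by apply/einj/(@perm_inj _ (p a)); rewrite h h' E.
by rewrite !mxE; apply: (gP j).1.
Qed.

(** Suppose [p b] takes the value at [e j0]. Row [b] of [L] holds the symbol in some column; a
    column other than [j0] would contradict injectivity of [p b]. So it is column [j0], and the
    Latin property gives [b = a]. *)
Lemma agree_last_column (d : nat) (V : finType) (p : {ffun 'I_d -> {perm V}})
    (e f : 'I_d -> V) (j0 : 'I_d) (L : 'M['I_d]_d) (a : 'I_d) :
  injective e -> injective f -> is_latin L ->
  (forall b j, j != j0 -> p b (e j) = f (L b j)) ->
  hits p (e j0) (f (L a j0)) -> p a (e j0) = f (L a j0).
Proof.
move=> einj finj /latinP[Lrow Lcol] agree /existsP[b /eqP Eb].
have [j Ej] := ord_inj_surj (L a j0) (Lrow b).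
have [jj0|jj0] := eqVneq j j0; last first.
  have E : p b (e j) = p b (e j0) by rewrite (agree b j jj0) Ej Eb.
  by rewrite (einj _ _ (perm_inj E)) eqxx in jj0.
by rewrite jj0 in Ej; rewrite -{1}(Lcol _ _ _ Ej).
Qed.

(** * Counting the tuples that cover or nearly cover a given block *)

Lemma card_ffun_family (I T : finType) (F : I -> {set T}) :
  #|[set p : {ffun I -> T} | [forall a, p a \in F a]]| = \prod_a #|F a|.
Proof. by rewrite cardsE card_family foldrE big_map big_enum. Qed.

Lemma double_count (I J : finType) (A : {set I}) (R : I -> J -> bool) :
  \sum_(i in A) #|[set j | R i j]| = \sum_j #|[set i in A | R i j]|.
Proof.
under eq_bigr do rewrite -sum1dep_card big_mkcond /=.
rewrite exchange_big /=; apply: eq_bigr => j _.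
by rewrite -big_mkcondr sum1dep_card.
Qed.

Lemma card_ord_neq (d : nat) (j0 : 'I_d) : #|[set j | j != j0]| = d.-1.
Proof.
rewrite (_ : [set j | j != j0] = ~: [set j0]) ?cardsC1 ?card_ord //.
by apply/setP => j; rewrite !inE.
Qed.

(** Each Latin square prescribes [d - 1] values of every [p a], leaving [(d - 1)!] extensions, and
    all resulting tuples cover the block. Different squares give disjoint sets of tuples, since a
    square is determined by its columns other than [j0]. *)
Lemma count_covers_ge (d : nat) (V : finType) (S T : {set V}) :
  2 <= d -> #|V| = 2 * d - 2 -> #|S| = d.-1 -> #|T| = d ->
  num_latin d * (d - 1)`! ^ d <=
  #|[set p : {ffun 'I_d -> {perm V}} | covers (hits p) S T]|.
Proof.
move=> d2 cV cS cT.
(* An auxiliary element outside [S] labels the last column [j0] of the square, on which nothing is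
   prescribed. *)
have [c0 c0S] : exists c, c \in ~: S.
  by apply/card_gt0P; rewrite cardsCs setCK; lia.
rewrite inE in c0S.
have [e [einj eU]] : exists e : 'I_d -> V, injective e /\ e @: setT = c0 |: S.
  by apply: exists_enumeration; rewrite cardsU1 c0S cS; lia.
have [f [finj fT]] := exists_enumeration cT.
have /imsetP[j0 _ Ej0] : c0 \in e @: setT by rewrite eU setU11.
have eS j : (e j \in S) = (j != j0).
  have : e j \in c0 |: S by rewrite -eU imset_f.
  rewrite !inE Ej0 (inj_eq einj); case: eqVneq => [->|//].
  by rewrite -Ej0 (negbTE c0S).
pose J := [set j | j != j0].
pose F (L : 'M['I_d]_d) a := [set q : {perm V} | [forall j in J, q (e j) == f (L a j)]].
pose R (L : 'M['I_d]_d) (p : {ffun 'I_d -> {perm V}}) := [forall a, p a \in F L a].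
have RP (L : 'M['I_d]_d) (p : {ffun 'I_d -> {perm V}}) :
    reflect (forall a j, j != j0 -> p a (e j) = f (L a j)) (R L p).
  apply: (iffP forallP) => [h a j jj0|h a].
    by have := h a; rewrite inE => /forall_inP/(_ j) E; apply/eqP/E; rewrite inE.
  by rewrite inE; apply/forall_inP => j; rewrite inE => jj0; rewrite h.
have -> : num_latin d * (d - 1)`! ^ d =
    \sum_(L in [set L : 'M['I_d]_d | is_latin L]) #|[set p | R L p]|.
  rewrite -sum_nat_const; apply: eq_bigr => L; rewrite inE => /latinP[Lrow _].
  rewrite card_ffun_family (eq_bigr (fun=> (d - 1)`!)); last first.
    move=> a _; rewrite card_perm_extensions //; last exact: inj_comp.
    by rewrite cV card_ord_neq; congr (_`!); lia.
  by rewrite prod_nat_const card_ord.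
rewrite double_count -[leqRHS]sum1_card [leqRHS]big_mkcond; apply: leq_sum => p _.
have unique : #|[set L in [set L : 'M['I_d]_d | is_latin L] | R L p]| <= 1.
  apply/card_le1_eqP => L L'; rewrite !inE.
  move=> /andP[/latinP[Lr Lc] /RP RL] /andP[/latinP[Lr' Lc'] /RP RL'].
  have E a j : j != j0 -> L a j = L' a j.
    by move=> jj0; apply: finj; rewrite -RL // RL'.
  apply/matrixP => a j; have [->|/E//] := eqVneq j j0.
  (* The symbol [L a j0] lies somewhere in row [a] of [L']. A column other than [j0] is impossible,
     since there [L] and [L'] agree and [L] would repeat it. *)
  have [i Ei] := ord_inj_surj (L a j0) (Lr' a).
  have [ij0|ij0] := eqVneq i j0; first by rewrite -Ei ij0.
  by case/eqP: (ij0); apply: (Lr a); rewrite (E a i ij0).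
have [_|] := boolP (p \in _); first exact: unique.
rewrite inE => ncov; rewrite leqn0 cards_eq0; apply/eqP/setP => L.
rewrite !inE; apply/negP => /andP[/latinP[_ Lcol] /RP RL].
case/negP: ncov; apply/coversP => c x cS' xT.
have /imsetP[j _ Ej] : c \in e @: setT by rewrite eU inE cS' orbT.
have /imsetP[y _ Ey] : x \in f @: setT by rewrite fT.
have jj0 : j != j0 by rewrite -eS -Ej.
have [a Ea] := ord_inj_surj y (Lcol j).
by apply/existsP; exists a; rewrite Ej Ey RL // Ea.
Qed.

Lemma count_covers_ge_tall (d : nat) (V : finType) (S T : {set V}) :
  2 <= d -> #|V| = 2 * d - 2 -> #|S| = d -> #|T| = d.-1 ->
  num_latin d * (d - 1)`! ^ d <=
  #|[set p : {ffun 'I_d -> {perm V}} | covers (hits p) S T]|.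
Proof.
move=> d2 cV cS cT; apply: leq_trans (count_covers_ge d2 cV cT cS) _.
rewrite -(card_preimset _ (@inv_tuple_inj d V)); apply: eq_leq.
apply: eq_card => p; rewrite !inE -covers_transpose.
by apply/coversP/coversP => h c x cS' xT; move: (h c x cS' xT);
  rewrite /transpose hits_inv.
Qed.

(** [X] lies in a union of product sets indexed by Latin squares; these may overlap, so only an
    upper bound results. *)
Lemma card_le_num_latin (d : nat) (V : finType) (X : {set {ffun 'I_d -> {perm V}}})
    (F : 'M['I_d]_d -> 'I_d -> {set {perm V}}) (n : nat) :
  (forall p, p \in X ->
     exists L : 'M['I_d]_d, is_latin L /\ forall a, p a \in F L a) ->
  (forall L, is_latin L -> \prod_a #|F L a| = n) ->
  #|X| <= num_latin d * n.
Proof.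
move=> XF Fn; rewrite -sum_nat_const.
have -> : \sum_(L in [set L : 'M['I_d]_d | is_latin L]) n =
    \sum_(L in [set L : 'M['I_d]_d | is_latin L])
      #|[set p : {ffun 'I_d -> {perm V}} | [forall a, p a \in F L a]]|.
  by apply: eq_bigr => L; rewrite inE => /Fn <-; rewrite card_ffun_family.
rewrite double_count -sum1_card big_mkcond; apply: leq_sum => p _.
case: ifP => // /XF[L [latL pF]]; apply/card_gt0P; exists L.
by rewrite !inE latL; apply/forallP.
Qed.

Lemma count_covers_le (d : nat) (V : finType) (U T : {set V}) :
  2 <= d -> #|V| = 2 * d - 2 -> #|U| = d -> #|T| = d ->
  #|[set p : {ffun 'I_d -> {perm V}} | covers (hits p) U T]| <=
  num_latin d * (d - 2)`! ^ d.
Proof.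
move=> d2 cV cU cT.
have [e [einj eU]] := exists_enumeration cU; have [f [finj fT]] := exists_enumeration cT.
(* The whole block is covered, so any column can serve as the last one. *)
have j0 : 'I_d by apply: (@Ordinal d 0); lia.
apply: (card_le_num_latin (F := fun L a =>
   [set q : {perm V} | [forall j in setT, q (e j) == f (L a j)]])) => [p|L].
  rewrite inE => /coversP cov.
  have h j y : hits p (e j) (f y).
    by apply: cov; rewrite -?eU -?fT imset_f.
  have [L [latL agree]] := covers_latin einj finj (fun j y (_ : j != j0) => h j y).
  exists L; split=> // a; rewrite inE; apply/forall_inP => j _; apply/eqP.
  have [->|/agree->//] := eqVneq j j0.
  exact: agree_last_column.
case/latinP=> Lrow _; rewrite (eq_bigr (fun=> (d - 2)`!)).
  by rewrite prod_nat_const card_ord.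
move=> a _; rewrite card_perm_extensions //; last exact: inj_comp.
by rewrite cV cardsT card_ord; congr (_`!); lia.
Qed.

(** Every row of the Latin square has its [d] values forced, except the row with symbol [y0] in
    column [j0]. That row must agree off [j0] and disagree at [j0], which leaves
    [(d - 1)! - (d - 2)! = (d - 2) * (d - 2)!] permutations instead of [(d - 2)!]. *)
Lemma count_near_le (d : nat) (V : finType) (U T : {set V}) (c0 x0 : V) :
  2 <= d -> #|V| = 2 * d - 2 -> #|U| = d -> #|T| = d -> c0 \in U -> x0 \in T ->
  #|[set p : {ffun 'I_d -> {perm V}} | near_block (hits p) U T c0 x0]| <=
  num_latin d * ((d - 2) * (d - 2)`! ^ d).
Proof.
move=> d2 cV cU cT c0U x0T.
have [e [einj eU]] := exists_enumeration cU; have [f [finj fT]] := exists_enumeration cT.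
have /imsetP[j0 _ Ej0] : c0 \in e @: setT by rewrite eU.
have /imsetP[y0 _ Ey0] : x0 \in f @: setT by rewrite fT.
pose J := [set j | j != j0].
pose ext (D : {set 'I_d}) (L : 'M['I_d]_d) a :=
  [set q : {perm V} | [forall j in D, q (e j) == f (L a j)]].
apply: (card_le_num_latin (F := fun L a => if L a j0 == y0 then ext J L a :\: ext setT L a
  else ext setT L a)) => [p|L].
  rewrite inE => /and3P[/coversP cov1 /coversP cov2 ncov].
  have eq_f j : f j \in T by rewrite -fT imset_f.
  have eq_e j : e j \in U by rewrite -eU imset_f.
  have [|L [latL agree]] := @covers_latin _ _ p e f j0 einj finj.
    by move=> j y jj0; apply: cov1; rewrite ?inE // Ej0 (inj_eq einj) jj0 eq_e.
  have last a : L a j0 != y0 -> p a (e j0) = f (L a j0).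
    move=> ay; apply: (agree_last_column einj finj latL agree).
    by apply: cov2; rewrite // !inE Ey0 (inj_eq finj) ay eq_f.
  have allext a : (p a \in ext setT L a) = (p a (e j0) == f (L a j0)).
    rewrite inE; apply/forall_inP/idP => [|/eqP h j _]; first by apply.
    by have [->|/agree->//] := eqVneq j j0; apply/eqP.
  exists L; split=> // a; case: ifP => [/eqP ay|/negbT/last h]; last first.
    by rewrite allext h.
  rewrite inE allext; apply/andP; split; last first.
    by rewrite inE; apply/forall_inP => j; rewrite inE => /agree->.
  apply: contra ncov => /eqP Ea; apply/coversP => c x cU' xT.
  have [cc0|cc0] := eqVneq c c0; last by apply: cov1; rewrite ?inE ?cc0.
  have [xx0|xx0] := eqVneq x x0; last by apply: cov2; rewrite ?inE ?xx0.
  by apply/existsP; exists a; rewrite cc0 xx0 Ej0 Ey0 Ea ay.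
move=> latL; have /latinP[Lrow Lcol] := latL.
have extT a : #|ext setT L a| = (d - 2)`!.
  rewrite card_perm_extensions //; last exact: inj_comp.
  by rewrite cV cardsT card_ord; congr (_`!); lia.
have extJ a : #|ext J L a| = (d - 1) * (d - 2)`!.
  rewrite card_perm_extensions //; last exact: inj_comp.
  rewrite cV card_ord_neq (_ : _ - _ = (d - 2).+1) ?factS; last lia.
  by congr (_ * _); lia.
have extD a : #|ext J L a :\: ext setT L a| = (d - 2) * (d - 2)`!.
  have sub : ext setT L a \subset ext J L a.
    apply/subsetP => q; rewrite !inE => /forall_inP h.
    by apply/forall_inP => j _; apply: h.
  rewrite cardsD (setIidPr sub) extT extJ -{2}[(d - 2)`!]mul1n -mulnBl.
  by congr (_ * _); lia.
have [a0 Ea0] := ord_inj_surj y0 (Lcol j0).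
rewrite (bigD1 a0) //= Ea0 eqxx extD (eq_bigr (fun=> (d - 2)`!)); last first.
  move=> a aa0; case: eqP => [Ea|_]; last exact: extT.
  by case/eqP: aa0; apply: (Lcol j0); rewrite Ea Ea0.
rewrite prod_nat_const -mulnA -expnS; congr (_ * _ ^ _).
have := card_ord_neq a0; rewrite cardsE => ->; lia.
Qed.

(** * A lower bound for the number of unavoidable tuples *)

Definition avoidable (d : nat) (V : finType) (p : {ffun 'I_d -> {perm V}}) : bool :=
  [exists q : {perm V}, [forall a, [forall c, q c != p a c]]].

Lemma covers_not_avoidable (d : nat) (V : finType)
    (p : {ffun 'I_d -> {perm V}}) (S T : {set V}) :
  #|V| < #|S| + #|T| -> covers (hits p) S T -> ~~ avoidable p.
Proof.
move=> lt cov; apply/negP => /existsP[q /forallP qP].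
have [c /existsP[a /eqP E]] := no_avoiding_perm q lt cov.
by have /forallP/(_ c) := qP a; rewrite E eqxx.
Qed.

Lemma card_block_shapes (V : finType) (m n : nat) :
  #|[set B : {set V} * {set V} | (#|B.1| == m) && (#|B.2| == n)]| =
  'C(#|V|, m) * 'C(#|V|, n).
Proof.
rewrite -!card_draws -cardsX; apply: eq_card => -[S T].
by rewrite !inE.
Qed.

Lemma sum_nblocks (I V : finType) (r : I -> rel V) (m n : nat) :
  \sum_i nblocks (r i) m n =
  \sum_(B in [set B : {set V} * {set V} | (#|B.1| == m) && (#|B.2| == n)])
    #|[set i | covers (r i) B.1 B.2]|.
Proof.
rewrite double_count; apply: eq_bigr => i _.
by apply: eq_card => B; rewrite !inE andbA.
Qed.

Lemma sum_nnear_le (d : nat) (V : finType) :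
  2 <= d -> #|V| = 2 * d - 2 ->
  \sum_(p : {ffun 'I_d -> {perm V}}) nnear (hits p) d <=
  'C(2 * d - 2, d) ^ 2 * d ^ 2 * (num_latin d * ((d - 2) * (d - 2)`! ^ d)).
Proof.
move=> d2 cV.
pose A := [set B : ({set V} * {set V}) * (V * V) |
  ((#|B.1.1| == d) && (#|B.1.2| == d)) && ((B.2.1 \in B.1.1) && (B.2.2 \in B.1.2))].
have -> : 'C(2 * d - 2, d) ^ 2 * d ^ 2 = #|A|.
  rewrite -sum1dep_card -(pair_big_dep
    (fun B : {set V} * {set V} => (#|B.1| == d) && (#|B.2| == d))
    (fun (B : {set V} * {set V}) (z : V * V) => (z.1 \in B.1) && (z.2 \in B.2)) (fun _ _ => 1)) /=.
  rewrite (eq_bigr (fun=> d ^ 2)) => [|[U T] /= /andP[/eqP cU /eqP cT]].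
    by rewrite sum_nat_cond_const card_block_shapes cV mulnn.
  rewrite sum1dep_card -mulnn -{1}cU -cT -cardsX.
  by apply: eq_card => -[c x]; rewrite !inE.
rewrite -sum_nat_const.
have -> : \sum_(p : {ffun 'I_d -> {perm V}}) nnear (hits p) d =
    \sum_(B in A) #|[set p : {ffun 'I_d -> {perm V}} |
                      near_block (hits p) B.1.1 B.1.2 B.2.1 B.2.2]|.
  rewrite double_count; apply: eq_bigr => p _.
  by apply: eq_card => B; rewrite !inE -!andbA.
apply: leq_sum => B; rewrite inE => /andP[/andP[/eqP cU /eqP cT] /andP[cB xB]].
exact: count_near_le.
Qed.

(** This is [nblocks_bound] summed over all tuples. Its indicator term counts only unavoidable
    tuples, because the sides of a block add up to [2 * d - 1], one more than the size of [V]. *)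
Lemma card_not_avoidable_ge (d : nat) (V : finType) :
  2 <= d -> #|V| = 2 * d - 2 ->
  2 * ('C(2 * d - 2, d - 1) * 'C(2 * d - 2, d) * (num_latin d * (d - 1)`! ^ d)) <=
  #|[set p : {ffun 'I_d -> {perm V}} | ~~ avoidable p]| +
  ((2 * d - 1) * ('C(2 * d - 2, d) ^ 2 * (num_latin d * (d - 2)`! ^ d)) +
   'C(2 * d - 2, d) ^ 2 * d ^ 2 * (num_latin d * ((d - 2) * (d - 2)`! ^ d))).
Proof.
move=> d2 cV.
have d1 : d.-1 = d - 1 by lia.
pose tuples := {ffun 'I_d -> {perm V}}.
have lower1 : 'C(2 * d - 2, d - 1) * 'C(2 * d - 2, d) * (num_latin d * (d - 1)`! ^ d)
    <= \sum_(p : tuples) nblocks (hits p) d.-1 d.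
  rewrite sum_nblocks -cV -d1 -card_block_shapes -sum_nat_const.
  apply: leq_sum => B; rewrite inE => /andP[/eqP cS /eqP cT].
  by rewrite d1; apply: count_covers_ge.
have lower2 : 'C(2 * d - 2, d - 1) * 'C(2 * d - 2, d) * (num_latin d * (d - 1)`! ^ d)
    <= \sum_(p : tuples) nblocks (hits p) d d.-1.
  rewrite ['C(_, d - 1) * _]mulnC.
  rewrite sum_nblocks -cV -d1 -card_block_shapes -sum_nat_const.
  apply: leq_sum => B; rewrite inE => /andP[/eqP cS /eqP cT].
  by rewrite d1; apply: count_covers_ge_tall.
have upper : \sum_(p : tuples) nblocks (hits p) d d <=
    'C(2 * d - 2, d) ^ 2 * (num_latin d * (d - 2)`! ^ d).
  rewrite sum_nblocks -mulnn -{1 2}cV -card_block_shapes -sum_nat_const.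
  apply: leq_sum => B; rewrite inE => /andP[/eqP cS /eqP cT].
  exact: count_covers_le.
have near := sum_nnear_le d2 cV.
have bound : \sum_(p : tuples) nblocks (hits p) d.-1 d +
    \sum_(p : tuples) nblocks (hits p) d d.-1 <=
    #|[set p : tuples | ~~ avoidable p]| +
    ((2 * d - 1) * \sum_(p : tuples) nblocks (hits p) d d +
     \sum_(p : tuples) nnear (hits p) d).
  rewrite -sum1dep_card [X in _ <= X + _]big_mkcond big_distrr -!big_split /=.
  apply: leq_sum => p _.
  apply: leq_trans (nblocks_bound d2 cV (hits_degr p) (hits_degc p)) _.
  rewrite leq_add2r; case: posnP => //= pos.
  suff -> : ~~ avoidable p by [].
  move: pos; rewrite addn_gt0 => /orP[] /card_gt0P[[S T]];
    rewrite inE /= => /and3P[/eqP cS /eqP cT];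
    by apply: covers_not_avoidable; rewrite cV cS cT; lia.
rewrite mul2n -addnn; apply: leq_trans (leq_add lower1 lower2) _.
apply: leq_trans bound _; rewrite leq_add2l leq_add // leq_mul2l upper.
by rewrite orbT.
Qed.

Lemma num_latin_gt0 (d : nat) : 0 < d -> 0 < num_latin d.
Proof.
(* The witness is the addition table of the cyclic group on the ordinals. *)
case: d => // d _; apply/card_gt0P; exists (\matrix_(i, j) (i + j))%R.
rewrite inE; apply/latinP; split=> [i j j'|j i i']; rewrite !mxE.
  exact: addrI.
exact: addIr.
Qed.

(** * The union bound over packings of the small side *)

Lemma exists_unavoidable_family (d t : nat) (V : finType) :
  let K := #|{ffun 'I_d -> {perm V}}| in
  let g := #|[set p : {ffun 'I_d -> {perm V}} | avoidable p]| in
  K * g ^ t < K ^ t ->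
  exists s : {ffun 'I_t -> {ffun 'I_d -> {perm V}}},
    forall phi : {ffun 'I_d -> {perm V}},
    exists b, ~~ avoidable [ffun a => (phi a * s b a)%g].
Proof.
move=> K g lt; apply: contrapT => no.
pose tuples := {ffun 'I_d -> {perm V}}.
pose shift (phi p : tuples) : tuples := [ffun a => (phi a * p a)%g].
pose R (phi : tuples) (s : {ffun 'I_t -> tuples}) :=
  [forall b, s b \in [set p | avoidable (shift phi p)]].
(* Translation by a fixed [phi] is a bijection on tuples, so exactly [g ^ t] families are avoidable
   at every [b]. If each of the [K ^ t] families had such a [phi], this total would be at least
   [K ^ t]. *)
have cnt : \sum_(phi in [set: tuples]) #|[set s | R phi s]| = K * g ^ t.
  rewrite /K -cardsT -sum_nat_const; apply: eq_bigr => phi _.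
  rewrite card_ffun_family prod_nat_const card_ord; congr (_ ^ _).
  have shiftI : injective (shift phi).
    move=> p q /ffunP E; apply/ffunP => a; have := E a.
    by rewrite !ffunE => /mulgI.
  by rewrite /g -[in RHS](card_preimset _ shiftI); apply: eq_card => p; rewrite !inE.
move: lt; rewrite ltnNge -cnt double_count => /negP; apply.
have -> : K ^ t = \sum_(s : {ffun 'I_t -> tuples}) 1.
  by rewrite sum1_card card_ffun card_ord.
apply: leq_sum => s _; apply/card_gt0P.
apply: contrapT => none; apply: no; exists s => phi.
apply: contrapT => all; apply: none; exists phi; rewrite !inE.
apply/forallP => b; rewrite inE; apply: contraT => nb.
by case: all; exists b.
Qed.

(** * Packings as families of injections, and monotonicity in [k] *)

Definition packing_fun (G : sgraph) (k : nat) (H : corr_cover G k)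
    (phi : G -> 'I_k -> 'I_k) : Prop :=
  (forall u, injective (phi u)) /\
  forall u v c, ~~ H (u, phi u c) (v, phi v c).

(** Colouring number [c] uses the index [phi u c] at [u], so disjointness of the colourings becomes
    injectivity of each [phi u]. *)
Lemma corr_packingP (G : sgraph) (k : nat) (H : corr_cover G k) :
  (exists C, corr_packing H C) <-> (exists phi, packing_fun H phi).
Proof.
split=> [[C [col dis]]|[phi [inj indep]]].
  have ex u c : exists i, C c :&: [set x | x.1 == u] == [set (u, i)].
    have [_ /(_ u)/eqP/cards1P[[v i] E]] := col c.
    have : (v, i) \in C c :&: [set x | x.1 == u] by rewrite E set11.
    by rewrite !inE /= => /andP[_ /eqP vu]; exists i; rewrite E vu.
  pose phi u c := xchoose (ex u c).
  have phiC u c : (u, phi u c) \in C c.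
    have : (u, phi u c) \in [set (u, phi u c)] by rewrite set11.
    by rewrite -(eqP (xchooseP (ex u c))) inE => /andP[].
  exists phi; split=> [u c c' E|u v c]; last first.
    by have [indep _] := col c; apply: indep.
  apply/eqP; apply/negPn/negP => /dis/disjointFr/(_ (phiC u c)).
  by rewrite E phiC.
exists (fun c => [set x | x.2 == phi x.1 c]); split=> [c|c c' cc'].
  split=> [[u i] [v j]|v]; first by rewrite !inE /= => /eqP-> /eqP->.
  apply/eqP/cards1P; exists (v, phi v c); apply/setP => -[u i].
  by rewrite !inE /= xpair_eqE andbC; case: eqVneq => [->|].
rewrite -setI_eq0; apply/eqP/setP => -[u i]; rewrite !inE /=.
apply/negP => /andP[/eqP -> /eqP/inj ccE].
by rewrite ccE eqxx in cc'.
Qed.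

Definition subcover_edge (G : sgraph) (k l : nat) (H : corr_cover G l)
    (f : G -> 'I_k -> 'I_l) : rel (G * 'I_k) :=
  fun x y => H (x.1, f x.1 x.2) (y.1, f y.1 y.2).

Lemma subcover_exists (G : sgraph) (k l : nat) (H : corr_cover G l)
    (f : G -> 'I_k -> 'I_l) :
  (forall u, injective (f u)) ->
  exists H' : corr_cover G k, corr_edge H' = subcover_edge H f.
Proof.
move=> finj; unshelve eexists; first (unshelve eapply CorrCover).
- exact: subcover_edge H f.
- by move=> x y; apply: corr_sym.
- by move=> x; apply: corr_irr.
- by move=> v i j; apply: corr_indep.
- by move=> u v i j; apply: corr_nonadj.
- by move=> u v i j j' uv h h'; apply: (finj v); apply: corr_matching uv h h'.
- by [].
Qed.

(* Peel one colouring off a (k+1)-fold cover, then pack the remaining k-fold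
   cover. *)
Lemma corr_packableS (G : sgraph) (k : nat) :
  0 < k -> corr_packable G k -> corr_packable G k.+1.
Proof.
case: k => // k _ pack H; apply/corr_packingP.
(* [H1] drops index [ord0] everywhere, and one colouring of its packing is a colouring [s] of [H].
   Below, [H2] drops the index [s u] at each [u]. *)
have [H1 E1] := subcover_exists H (fun=> @lift_inj _ ord0).
have /corr_packingP[phi1 [_ indep1]] := pack H1.
pose s u := lift ord0 (phi1 u ord0).
have s_indep u v : ~~ H (u, s u) (v, s v).
  by have := indep1 u v ord0; rewrite E1.
have [H2 E2] := subcover_exists H (fun u => @lift_inj _ (s u)).
have /corr_packingP[phi2 [inj2 indep2]] := pack H2.
exists (fun u c => if unlift ord0 c is Some c' then lift (s u) (phi2 u c') else s u).
split=> [u c c'|u v c].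
  case: unliftP => [i ->|->]; case: unliftP => [i' ->|->] // E.
  - by rewrite (inj2 _ _ _ (lift_inj E)).
  - by have := neq_lift (s u) (phi2 u i); rewrite E eqxx.
  - by have := neq_lift (s u) (phi2 u i'); rewrite -E eqxx.
by case: unliftP => [c' _|_] //; have := indep2 u v c'; rewrite E2.
Qed.

Lemma corr_packable_mono (G : sgraph) (k l : nat) :
  0 < k -> k <= l -> corr_packable G k -> corr_packable G l.
Proof.
move=> k0 /subnK <- pack; elim: (l - k) => // n; rewrite addSn.
by apply: corr_packableS; rewrite addn_gt0 k0 orbT.
Qed.

(** * The cover of the complete bipartite graph given by a family of tuples *)

Definition tuple_edge (d t k : nat)
    (s : {ffun 'I_t -> {ffun 'I_d -> {perm 'I_k}}}) :
    rel (Kbip d t * 'I_k) :=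
  fun x y => match x.1, y.1 with
  | inl a, inr b => s b a x.2 == y.2
  | inr b, inl a => s b a y.2 == x.2
  | _, _ => false
  end.

Lemma tuple_cover_exists (d t k : nat)
    (s : {ffun 'I_t -> {ffun 'I_d -> {perm 'I_k}}}) :
  exists H : corr_cover (Kbip d t) k, corr_edge H = tuple_edge s.
Proof.
unshelve eexists; first (unshelve eapply CorrCover).
- exact: tuple_edge s.
- by move=> [[a|b] i] [[a'|b'] j].
- by move=> [[a|b] i].
- by move=> [a|b] i j.
- by move=> [a|b] [a'|b'] i j.
- move=> [a|b] [a'|b'] i j j' //= _; rewrite /tuple_edge /=.
    by move=> /eqP <- /eqP.
  by move=> /eqP <- /eqP/perm_inj.
- by [].
Qed.

(** In a packing, colour [c] has index [phi a c] at [a], whose neighbour at [b] is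
    [s b a (phi a c)]. The permutation at [b] must differ from it for all [a] and [c], which makes
    the product tuple avoidable. *)
Lemma not_packable_Kbip (d t k : nat)
    (s : {ffun 'I_t -> {ffun 'I_d -> {perm 'I_k}}}) :
  (forall phi : {ffun 'I_d -> {perm 'I_k}},
     exists b, ~~ avoidable [ffun a => (phi a * s b a)%g]) ->
  ~ corr_packable (Kbip d t) k.
Proof.
move=> sP pack; have [H HE] := tuple_cover_exists s.
have /corr_packingP[phi [inj indep]] := pack H.
have [b /negP] := sP [ffun a => perm (inj (inl a))]; apply.
apply/existsP; exists (perm (inj (inr b))).
apply/forallP => a; apply/forallP => c; rewrite !ffunE permM !permE.
by have := indep (inl a) (inr b) c; rewrite HE /tuple_edge /= eq_sym.
Qed.

(** * Real estimates and the conclusion *)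

Local Open Scope ring_scope.

(** From [1 - x <= exp (- x)] at [x = D / K], the power [((K - n) / K) ^ t] is at most
    [exp (- t * D / K)], which is below [1 / K]. *)
Lemma union_bound (R : realType) (K n t : nat) (D : R) :
  (0 < K)%N -> (n <= K)%N -> D <= n%:R -> ln (K%:R : R) < t%:R * (D / K%:R) ->
  (K * (K - n) ^ t < K ^ t)%N.
Proof.
move=> K0 nK Dn lt.
have K0' : 0 < K%:R :> R by rewrite ltr0n.
have frac : (K - n)%:R / K%:R <= expR (- (D / K%:R)) :> R.
  apply: le_trans (expR_ge1Dx _); rewrite natrB // mulrBl divff ?gt_eqF //.
  by rewrite lerD2l lerN2 ler_pM2r ?invr_gt0.
have frac0 : 0 <= (K - n)%:R / K%:R :> R by rewrite divr_ge0.
have : ((K - n)%:R / K%:R) ^+ t < K%:R^-1 :> R.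
  apply: le_lt_trans (_ : expR (- (D / K%:R)) ^+ t < _).
    by rewrite lerXn2r ?nnegrE // expR_ge0.
  rewrite -expRM_natl -[X in _ < X^-1](@lnK R) ?posrE // -expRN ltr_expR.
  by rewrite mulrN ltrN2.
rewrite expr_div_n ltr_pdivrMr ?exprn_gt0 // mulrC ltr_pdivlMr // mulrC.
by rewrite -!natrX -natrM ltr_nat.
Qed.

(** After removing the factor [(d - 2)! ^ d], put [x = d - 1]. Then [2 * x ^ d >= 2 * x ^ 3 > x ^ 2
    * (x + 1 / d)], since [1 / d < 1 <= x]. *)
Lemma ybound_denominator_gt0 (R : realType) (d : nat) : (2 <= d)%N ->
  0 < (num_latin d)%:R * 'C(2 * d - 2, d)%:R * 'C(2 * d - 2, d - 1)%:R *
   (2%:R * ((d - 1)`!)%:R ^+ d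
    - (d%:R - 1) ^+ 2 * (d%:R - 1 + d%:R^-1) * ((d - 2)`!)%:R ^+ d) :> R.
Proof.
move=> d2.
rewrite !mulr_gt0 ?ltr0n ?num_latin_gt0 ?bin_gt0 //; try lia.
have [n ->] : exists n, d = n.+2 by exists (d - 2)%N; lia.
rewrite !subSS !subn0 factS natrM exprMn mulrA -mulrBl.
rewrite mulr_gt0 ?exprn_gt0 ?ltr0n ?fact_gt0 //.
have -> : n.+2%:R - 1 = n.+1%:R :> R by rewrite -[n.+2]addn1 natrD addrK.
have x1 : 1 <= n.+1%:R :> R by rewrite ler1n.
have x3 : n.+1%:R ^+ 3 <= n.+1%:R ^+ n.+2 :> R.
  (* For [d = 2] the exponent is below [3], but the base is [1]. *)
  case: n x1 => [|n] x1; first by rewrite !expr1n lexx.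
  by apply: ler_weXn2l.
have inv : n.+2%:R^-1 < 1 :> R by rewrite invf_lt1 ?ltr1n ?ltr0n.
rewrite subr_gt0.
apply: lt_le_trans (_ : 2%:R * n.+1%:R ^+ 3 <= _); last by rewrite ler_pM2l.
move: x1 inv; move: (n.+1%:R : R) (n.+2%:R^-1 : R) => x z x1 z1.
have x0 : 0 < x by lra.
have -> : 2%:R * x ^+ 3 = x ^+ 2 * (2%:R * x) by ring.
by rewrite ltr_pM2l ?exprn_gt0 //; lra.
Qed.

(** The left side equals the bound of [card_not_avoidable_ge]. One replaces a factor
    ['C(2 * d - 2, d)] by [(d - 1) / d * 'C(2 * d - 2, d - 1)] and uses [2 * d - 1 + d ^ 2 * (d - 2)
    = (d - 1) * (d ^ 2 - d + 1)]. *)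
Lemma ybound_denominator_le (R : realType) (d : nat) (V : finType) :
  (2 <= d)%N -> #|V| = (2 * d - 2)%N ->
  (num_latin d)%:R * 'C(2 * d - 2, d)%:R * 'C(2 * d - 2, d - 1)%:R *
   (2%:R * ((d - 1)`!)%:R ^+ d
    - (d%:R - 1) ^+ 2 * (d%:R - 1 + d%:R^-1) * ((d - 2)`!)%:R ^+ d)
  <= #|[set p : {ffun 'I_d -> {perm V}} | ~~ avoidable p]|%:R :> R.
Proof.
move=> d2 cV; have := card_not_avoidable_ge d2 cV.
move: #|[set p | _]| => bad.
have dC : (d * 'C(2 * d - 2, d) = (d - 1) * 'C(2 * d - 2, d - 1))%N.
  have [n E] : exists n, d = n.+1 by exists (d - 1)%N; lia.
  rewrite E mul_bin_left subSS subn0; congr (_ * _)%N; lia.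
have [n E] : exists n, d = n.+2 by exists (d - 2)%N; lia.
move: dC; rewrite -(ler_nat R) => /(congr1 (fun m => m%:R : R)).
have -> : (2 * d - 1)%N = (2 * n + 3)%N by lia.
move: ('C(2 * d - 2, d)) ('C(2 * d - 2, d - 1)) (num_latin d) => C1 C2 N.
move: (d - 1)`! (d - 2)`! => F1 F2.
rewrite E !subSS !subn0 !(natrD, natrM, natrX) -![n.+2]addn2 -![n.+1]addn1 !natrD.
move: (F1%:R ^+ _) (F2%:R ^+ _) => X Y.
have x0 : 0 <= n%:R :> R by [].
move: (n%:R) (C1%:R) (C2%:R) (N%:R) (bad%:R) x0 => x c1 c2 N' b x0 dC h.
have c2E : c1 = (x + 1) * c2 / (x + 2%:R).
  by rewrite -dC mulrC mulKf // gt_eqF //; lra.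
rewrite -subr_ge0; rewrite -subr_ge0 in h; apply: le_trans h _.
rewrite le_eqVlt; apply/orP; left; apply/eqP.
by rewrite c2E; field; rewrite gt_eqF //; lra.
Qed.

Lemma not_packable_Kbip_ybound (R : realType) (d t : nat) :
  (2 <= d)%N -> ybound R d * (d%:R * ln (((2 * d - 2)`!)%:R : R)) < t%:R ->
  ~ corr_packable (Kbip d t) (2 * d - 2).
Proof.
move=> d2 hty; set k := (2 * d - 2)%N in hty *.
have cK : #|{ffun 'I_d -> {perm 'I_k}}| = (k`! ^ d)%N.
  by rewrite card_ffun card_ord card_Sn.
have k1 : 1 <= (k`!)%:R :> R by rewrite ler1n fact_gt0.
have D0 := ybound_denominator_gt0 R d2.
have Dle := ybound_denominator_le R d2 (card_ord k).
rewrite -/k in D0 Dle; move: hty; rewrite /ybound -/k.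
set D := (num_latin d)%:R * _ * _ * _ in D0 Dle *; move=> hty.
pose bad := [set p : {ffun 'I_d -> {perm 'I_k}} | ~~ avoidable p].
have : (k`! ^ d * (k`! ^ d - #|bad|) ^ t < (k`! ^ d) ^ t)%N.
  apply: (@union_bound R _ _ _ D) => //.
  - by rewrite expn_gt0 fact_gt0.
  - by rewrite -cK max_card.
  (* With [K = k! ^ d], [ybound] is [K / D] and [d * ln k!] is [ln K], so the hypothesis on [t] is
     the one that [union_bound] asks for. *)
  rewrite natrX lnXn ?(lt_le_trans ltr01) //.
  have X0 : 0 < (k`!)%:R ^+ d :> R by rewrite exprn_gt0 // (lt_le_trans ltr01).
  rewrite mulrA ltr_pdivlMr // -[ln _ *+ d]mulr_natl mulrC.
  by move: hty; rewrite mulrAC ltr_pdivrMr.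
rewrite -cK.
have -> : (#|{ffun 'I_d -> {perm 'I_k}}| - #|bad|)%N =
    #|[set p : {ffun 'I_d -> {perm 'I_k}} | avoidable p]|.
  rewrite [RHS]cardsCs; congr (_ - _)%N.
  by apply: eq_card => p; rewrite !inE.
by move=> /exists_unavoidable_family[s sP]; apply: not_packable_Kbip sP.
Qed.

Theorem theorem3 (R : realType) (d t : nat)
  (hd : (2 <= d)%N) (ht : (0 < t)%N)
  (hty : ybound R d * (d%:R * ln (((2 * d - 2)`!)%:R : R)) < t%:R) :
  (2 * d - 1 <= corr_packing_number (Kbip d t))%N.
Proof.
rewrite /corr_packing_number; case: ex_minnP => m /andP[m0 /asboolP pack] _.
(* A smaller packing number would carry packability up to [2 * d - 2] by monotonicity. *)
rewrite leqNgt; apply/negP => lt; apply: (not_packable_Kbip_ybound hd hty).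
by apply: corr_packable_mono pack => //; lia.
Qed.
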